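(* Let $G$ be a simple $3$-connected graph with $n$ vertices and $m$ edges. Let $c(G)$ denote the length of a longest cycle of $G$ and $c^*(G)$ the size of a largest bond of $G$. If either (i) $c(G)\ge n-3$, or (ii) $c^*(G)\ge m-n-1$, then every longest cycle of $G$ meets every largest bond of $G$; that is, for every cycle $C$ of length $c(G)$ and every bond $B$ with $|B|=c^*(G)$, we have $E(C)\cap B\neq\emptyset$.
   Context: All graphs are simple. A bond of a graph is a minimal nonempty edge-cut. Equivalently, for a connected graph $G$, a bond is a set of edges $[X,Y]$ between the parts of a partition $V(G)=X\cup Y$ (with $X,Y$ nonempty) such that the induced subgraphs $G[X]$ and $G[Y]$ are both connected. A cycle $C$ meets a bond $B$ if they have at least one common edge. A graph is $k$-connected if it has at least $k+1$ vertices and remains connected whenever fewer than $k$ vertices are removed. *)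

(* Defs.v *)
From mathcomp Require Import all_boot.
Set Implicit Arguments. Unset Strict Implicit. Unset Printing Implicit Defensive.

Definition simple_graph (T : finType) (g : rel T) : Prop :=
  symmetric g /\ irreflexive g.

Section Graph.
Variables (T : finType) (g : rel T).

Definition edges : {set {set T}} :=
  [set f : {set T} | [exists x, exists y, (f == [set x; y]) && g x y]].

Definition induced_connected (A : {set T}) : bool :=
  [forall x in A, forall y in A,
     connect [rel u v | [&& g u v, u \in A & v \in A]] x y].

Definition k_connected (k : nat) : bool :=
  (k.+1 <= #|T|) &&
  [forall S : {set T}, (#|S| < k) ==> induced_connected (~: S)].

Definition is_cycle (s : seq T) : bool :=
  [&& 2 < size s, uniq s & cycle g s].

Definition cycle_edges (s : seq T) : {set {set T}} :=
  [set [set x; next s x] | x in s].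

(* c(G): the length of a longest cycle (0 if there is no cycle). *)
Definition circumference : nat :=
  \max_(k < #|T|.+1 | [exists t : k.-tuple T, is_cycle t]) k.

Definition cut (X : {set T}) : {set {set T}} :=
  [set f in edges | #|f :&: X| == 1].

Definition is_edge_cut (B : {set {set T}}) : bool :=
  [exists X : {set T}, B == cut X].

Definition is_bond (B : {set {set T}}) : bool :=
  [&& B != set0, is_edge_cut B &
      [forall B' : {set {set T}},
         ((B' \proper B) && is_edge_cut B') ==> (B' == set0)]].

Definition max_bond_size : nat :=
  \max_(B : {set {set T}} | is_bond B) #|B|.

End Graph.

(* Main.v *)
Require Import Defs.
From mathcomp Require Import all_boot.
From mathcomp Require Import zify.

(** Let [B] be the cut between [X] and its complement [Y], both sides being
connected. A cycle [C] missing [B] lies in one side, say [X]. If [S] is a set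
of vertices of [X] for which [X \ S] and [Y + S] are still connected, then
[X \ S, Y + S] is again a bond, so maximality of [B] gives
e(S, X \ S) <= e(S, Y). On the other hand, for a connected [Q] disjoint from
[C], maximality of [C] forbids consecutive vertices of [C] with neighbours in
[Q], and vertices at distance two on [C] have at most a single common
neighbour in [Q] and no other one.

If [C] has at least n - 3 vertices, [Y] is so small that transferring a
suitable neighbour [v] of [Y] on [C] and its one or two successors violates
the exchange inequality.

If [B] has at least m - n - 1 edges, then e(X) <= |X| + 2. Let [Q] be the
component of G - C containing [Y], [R] the vertices of [C] with a neighbour in
[Q] and [U] the other vertices of [C]. By 3-connectedness |R| >= 3, and
|U| >= |R| since no two vertices of [R] are consecutive. Minimum degree 3
and sparsity give |U| <= 4 < 2|R|, so two vertices of [R] are at distance two;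
they share their only neighbour in [Q], which lies in [X] by the exchange
inequality, and adding it to G - Q improves the count to |U| <= 2. *)

Set Implicit Arguments. Unset Strict Implicit. Unset Printing Implicit Defensive.

(** * Degrees, edge counts, cuts and connected sets *)

Section EdgeCounts.
Variables (T : finType) (g : rel T).
Hypotheses (gsym : symmetric g) (girr : irreflexive g).
Implicit Types (A B D K S X W : {set T}) (x y v : T).

Definition deg_in x A : nat := \sum_(y in A) g x y.

(** Ordered pairs are counted: for disjoint sets this is the number of edges between them, while
    [edge_count A A] is twice the number of edges inside [A]. *)
Definition edge_count A B : nat := \sum_(x in A) deg_in x B.

Lemma deg_in_split x A S :
  S \subset A -> deg_in x A = deg_in x S + deg_in x (A :\: S).
Proof. by move=> sSA; rewrite /deg_in (big_setID S) /= (setIidPr sSA). Qed.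

Lemma deg_in1 x y : deg_in x [set y] = g x y.
Proof. exact: big_set1. Qed.

Lemma deg_in_U1 x y A : x \notin A -> deg_in y (x |: A) = g y x + deg_in y A.
Proof. by move=> xA; rewrite /deg_in big_setU1. Qed.

Lemma deg_in_card x A : deg_in x A = #|[set y in A | g x y]|.
Proof.
rewrite -sum1_card /deg_in [RHS](eq_bigl (fun y => (y \in A) && g x y)).
  by rewrite big_mkcondr; apply: eq_bigr => y _; case: (g x y).
by move=> y; rewrite inE.
Qed.

Lemma deg_in_le_card x A : deg_in x A <= #|A|.
Proof.
by rewrite deg_in_card subset_leq_card //; apply/subsetP => y; rewrite inE; case/andP.
Qed.

Lemma deg_in_subset x A B : A \subset B -> deg_in x A <= deg_in x B.
Proof. by move=> sAB; rewrite (deg_in_split _ sAB) leq_addr. Qed.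

Lemma deg_in_ge1 x y A : y \in A -> g x y -> 0 < deg_in x A.
Proof. by move=> yA gxy; rewrite /deg_in (big_setD1 y) //= gxy. Qed.

Lemma deg_in_ge2 x y z A :
  y \in A -> z \in A -> y != z -> g x y -> g x z -> 1 < deg_in x A.
Proof.
move=> yA zA yz gxy gxz; rewrite deg_in_card; apply/card_gt1P.
by exists y, z; rewrite !inE yA zA gxy gxz.
Qed.

Lemma deg_in_ge3 x y z t A :
  y \in A -> z \in A -> t \in A -> y != z -> y != t -> z != t ->
  g x y -> g x z -> g x t -> 2 < deg_in x A.
Proof.
move=> yA zA tA yz yt zt gxy gxz gxt; rewrite deg_in_card; apply/card_gt2P.
by exists y, z, t; rewrite !inE yA zA tA gxy gxz gxt yz zt eq_sym yt.
Qed.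

Lemma deg_in_gt0P x A : 0 < deg_in x A -> exists2 y, y \in A & g x y.
Proof.
by rewrite deg_in_card => /card_gt0P[y]; rewrite inE => /andP[yA gxy]; exists y.
Qed.

Lemma deg_in_eq0 x A : (forall y, y \in A -> ~~ g x y) -> deg_in x A = 0.
Proof. by move=> H; rewrite /deg_in big1 // => y /H; case: (g x y). Qed.

Lemma edge_countC A B : edge_count A B = edge_count B A.
Proof.
rewrite /edge_count /deg_in exchange_big; apply: eq_bigr => y _.
by apply: eq_bigr => x _; rewrite gsym.
Qed.

Lemma edge_count1 x B : edge_count [set x] B = deg_in x B.
Proof. exact: big_set1. Qed.

Lemma edge_count_splitl A B S :
  S \subset A -> edge_count A B = edge_count S B + edge_count (A :\: S) B.
Proof. by move=> sSA; rewrite /edge_count (big_setID S) /= (setIidPr sSA). Qed.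

Lemma edge_count_splitr A B S :
  S \subset B -> edge_count A B = edge_count A S + edge_count A (B :\: S).
Proof. by move=> sSB; rewrite edge_countC (edge_count_splitl _ sSB) !(edge_countC _ A). Qed.

Lemma edge_count_ge A B k :
  (forall x, x \in A -> k <= deg_in x B) -> k * #|A| <= edge_count A B.
Proof. by move=> H; rewrite mulnC -sum_nat_const; apply: leq_sum. Qed.

Lemma edge_count_U1l x A B :
  x \notin A -> edge_count (x |: A) B = deg_in x B + edge_count A B.
Proof. by move=> xA; rewrite /edge_count big_setU1. Qed.

Lemma edge_count_U1 x A :
  x \notin A -> edge_count (x |: A) (x |: A) = edge_count A A + 2 * deg_in x A.
Proof.
move=> xA; rewrite edge_count_U1l // edge_countC edge_count_U1l //.
rewrite (@deg_in_split x _ [set x]) ?sub1set ?setU11 // deg_in1 girr add0n.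
by rewrite setU1K // mulSn mul1n addnA addnC.
Qed.

(** Every fibre of the map sending [(x, y)] to [[set x; y]] over an edge has two elements, distinct
    by irreflexivity. *)
Lemma card_edge_pairs (F : {set {set T}}) :
  F \subset edges g ->
  #|[set p : T * T | g p.1 p.2 && ([set p.1; p.2] \in F)]| = 2 * #|F|.
Proof.
move=> sF; set P := [set p | _].
rewrite -sum1_card (partition_big (fun p : T * T => [set p.1; p.2]) (mem F)) /=; last first.
  by move=> p; rewrite inE => /andP[].
rewrite (eq_bigr (fun=> 2)); first by rewrite sum_nat_const mulnC.
move=> f fF.
have := subsetP sF f fF; rewrite inE => /existsP[a /existsP[b /andP[/eqP fE gab]]].
have ab : a != b by apply: contraTneq gab => ->; rewrite girr.
rewrite sum1dep_card -(_ : #|[set (a, b); (b, a)]| = 2); last first.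
  by rewrite cards2 xpair_eqE negb_and ab.
apply: eq_card => -[x y]; rewrite !inE /= !xpair_eqE.
apply/idP/idP => [/andP[/andP[gxy _] /eqP E]|].
  have xy : x != y by apply: contraTneq gxy => ->; rewrite girr.
  have xab : x \in [set a; b] by rewrite -fE -E set21.
  have yab : y \in [set a; b] by rewrite -fE -E set22.
  move: xab yab xy; rewrite !inE.
  by do 2![case/orP=> /eqP->]; rewrite ?eqxx ?orbT.
case/orP=> /andP[/eqP-> /eqP->]; first by rewrite gab -fE fF eqxx.
by rewrite gsym gab setUC -fE fF eqxx.
Qed.

Lemma edge_count_pairs A B :
  #|[set p : T * T | g p.1 p.2 && ((p.1 \in A) && (p.2 \in B))]| = edge_count A B.
Proof.
rewrite -sum1_card /edge_count /deg_in pair_big_dep /= [LHS]big_mkcond [RHS]big_mkcond /=.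
apply: eq_bigr => -[x y] _; rewrite !inE /=.
by case: (g x y); case: (x \in A); case: (y \in B).
Qed.

Lemma card_edges : edge_count setT setT = 2 * #|edges g|.
Proof.
rewrite -card_edge_pairs // -edge_count_pairs //.
apply: eq_card => -[x y]; rewrite !inE /= andbT.
case gxy: (g x y) => //=; apply/esym/existsP; exists x; apply/existsP; exists y.
by rewrite eqxx gxy.
Qed.

Lemma in_cut X x y : g x y -> ([set x; y] \in cut g X) = ((x \in X) != (y \in X)).
Proof.
move=> gxy; rewrite inE.
have -> /= : [set x; y] \in edges g.
  by rewrite inE; apply/existsP; exists x; apply/existsP; exists y; rewrite eqxx gxy.
have xy : x != y by apply: contraTneq gxy => ->; rewrite girr.
rewrite setIUl cardsU.
have H z : [set z] :&: X = if z \in X then [set z] else set0.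
  apply/setP => t; case zX: (z \in X); rewrite !inE.
    by case: eqP => //= ->.
  by case: eqP => //= ->.
have -> : [set x] :&: X :&: ([set y] :&: X) = set0.
  apply/setP => t; rewrite !inE; case: eqP => //= ->; by rewrite (negbTE xy) andbF.
by rewrite !H cards0 subn0; case: (x \in X); case: (y \in X); rewrite ?cards1 ?cards0.
Qed.

Lemma mem_cut X f : f \in cut g X ->
  exists x y, [/\ f = [set x; y], g x y, x \in X & y \notin X].
Proof.
move=> fX; have : f \in edges g by move: fX; rewrite inE; case/andP.
rewrite inE => /existsP[a /existsP[b /andP[/eqP fE gab]]].
move: fX; rewrite fE in_cut //; case aX: (a \in X); case bX: (b \in X) => // _.
  by exists a, b; rewrite aX bX.
by exists b, a; rewrite aX bX setUC gsym.
Qed.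

Lemma cutC X : cut g (~: X) = cut g X.
Proof.
apply/setP => f; apply/idP/idP => /mem_cut[x [y [-> gxy]]];
by rewrite in_cut // !in_setC; case: (x \in X); case: (y \in X).
Qed.

(** The ordered pairs over the cut split according to which end lies in [X], and symmetry makes the
    two halves equinumerous. *)
Lemma card_cut X : #|cut g X| = edge_count X (~: X).
Proof.
have sF : cut g X \subset edges g by apply/subsetP => f; rewrite inE => /andP[].
apply/eqP; rewrite -(eqn_pmul2l (isT : 0 < 2)); apply/eqP.
rewrite -card_edge_pairs // mulSn mul1n {2}edge_countC -!edge_count_pairs //.
set P1 := [set p | _ & (p.1 \in X) && _]; set P2 := [set p | _ & (p.1 \in ~: X) && _].
have dP : P1 :&: P2 = set0.
  by apply/setP => -[x y]; rewrite !inE /=; case: (g x y); case: (x \in X); case: (y \in X).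
rewrite -cardsUI dP cards0 addn0; apply: eq_card => -[x y].
rewrite [LHS]in_set [RHS]inE 2!(in_set (fun _ => g _ _ && _)) /=.
by case gxy: (g x y) => //=; rewrite in_cut // !in_setC; case: (x \in X); case: (y \in X).
Qed.

(** Connectedness in cut form, which yields directly the edges needed later. The empty set counts as
    connected. *)
Definition connected A : Prop :=
  forall D, D \subset A -> D != set0 -> D != A ->
  exists x y, [/\ x \in D, y \in A :\: D & g x y].

Lemma connectedP A : reflect (connected A) (induced_connected g A).
Proof.
pose r := [rel u v | [&& g u v, u \in A & v \in A]].
have rsym : symmetric r by move=> u v /=; rewrite gsym (andbC (u \in A)).
apply: (iffP idP) => [cA D sDA /set0Pn[x xD] DA|cA].
  have [y yA yD] : exists2 y, y \in A & y \notin D.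
    by apply/subsetPn; apply: contra DA => ?; rewrite eqEsubset sDA.
  case: (boolP [exists u in D, exists v in A :\: D, g u v]) => [|H].
    by case/exists_inP => u uD /exists_inP[v vD guv]; exists u, v.
  have clD : closed r D.
    apply: (intro_closed (sym_connect_sym rsym)) => u v /and3P[guv uA vA] uD.
    apply: contraR H => vD; apply/exists_inP; exists u => //.
    by apply/exists_inP; exists v; rewrite // inE vD.
  have := forall_inP cA x (subsetP sDA x xD) => /forall_inP/(_ y yA).
  by move/(closed_connect clD); rewrite xD (negbTE yD).
apply/forall_inP => x xA; apply/forall_inP => y yA.
(* An edge of [A] leaving the set reachable from [x] would extend it, so this set is all of [A]. *)
pose D := [set z in A | connect r x z].
have sD : D \subset A by apply/subsetP => z; rewrite inE => /andP[].
have xD : x \in D by rewrite inE xA /=.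
case: (eqVneq D A) => [DA|nDA].
  by move: yA; rewrite -{1}DA inE => /andP[].
have [|u [v []]] := cA D sD _ nDA; first by apply/set0Pn; exists x.
rewrite !inE => /andP[uA cu] /andP[nv vA] guv; case/negP: nv; rewrite vA /=.
by apply: connect_trans cu (connect1 _); rewrite /= guv uA.
Qed.

Lemma connected1 x : connected [set x].
Proof. by move=> D; rewrite subset1 => /orP[/eqP->|/eqP->]; rewrite ?eqxx. Qed.

(** Only sets avoiding [K] need checking: a set containing [K] is handled through its complement in
    [A], and a set meeting [K] partially is left by an edge inside [K]. *)
Lemma connected_extend A K :
  K \subset A -> K != set0 -> connected K ->
  (forall D, D \subset A :\: K -> D != set0 ->
     exists x y, [/\ x \in D, y \in A :\: D & g x y]) ->
  connected A.
Proof.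
move=> sKA K0 cK H D sDA D0 DA.
case: (eqVneq (D :&: K) set0) => [dDC|DK0].
  apply: H => //; apply/subsetP => x xD; rewrite inE (subsetP sDA) // andbT.
  by apply/negP => xC; move/setP/(_ x): dDC; rewrite !inE xD xC.
case: (eqVneq (D :&: K) K) => [sCD|DCC].
  have [||x [y []]] := H (A :\: D).
  - by rewrite setDS // -sCD subsetIl.
  - by rewrite setD_eq0; apply: contra DA => ?; rewrite eqEsubset sDA.
  rewrite !inE => /andP[xD xA] /andP[]; rewrite negb_and negbK => /orP[yD|/negP//] yA gxy.
  by exists y, x; rewrite !inE yD xD xA gsym.
have [x [y []]] := cK (D :&: K) (subsetIr _ _) DK0 DCC.
rewrite !inE => /andP[xD xC] /andP[nyD yC] gxy; exists x, y.
by rewrite !inE xD gxy (subsetP sKA) // andbT; split=> //; rewrite yC andbT in nyD.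
Qed.

Lemma connected_setU1 A x y :
  connected A -> y \in A -> g x y -> connected (x |: A).
Proof.
move=> cA yA gxy; case: (boolP (x \in A)) => [xA|xA]; first by rewrite setUC (setUidPl _) ?sub1set.
apply: (connected_extend (K := A)); rewrite ?subsetU1 //; first by apply/set0Pn; exists y.
move=> D sD /set0Pn[z zD]; have zx : z = x.
  by move: (subsetP sD z zD); rewrite !inE => /andP[nz /orP[/eqP//|zA]]; rewrite zA in nz.
exists x, y; rewrite -{1}zx zD gxy !inE yA orbT andbT; split=> //.
by apply/negP => /(subsetP sD); rewrite !inE yA.
Qed.

Lemma connected_path x p : path g x p -> connected [set z in x :: p].
Proof.
elim: p x => [|y p IH] x /=.
  by move=> _; rewrite (_ : [set z in _] = [set x]); [exact: connected1|apply/setP=> z; rewrite !inE].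
case/andP=> gxy pp; rewrite (_ : [set z in _] = x |: [set z in y :: p]).
  by apply: (connected_setU1 (IH _ pp) _ gxy); rewrite inE mem_head.
by apply/setP => z; rewrite !inE.
Qed.

Lemma connected_join A x y : connected A -> x \in A -> y \in A ->
  exists p, [/\ path g x p, last x p = y, uniq (x :: p) & {subset x :: p <= A}].
Proof.
move=> /connectedP cA xA yA.
have /connectP[p0 pp0 ->] := forall_inP (forall_inP cA x xA) y yA.
have [p pp up _] := shortenP pp0.
exists p; split=> //; first by apply: sub_path pp => u v /and3P[].
elim: p x xA pp {pp0 up} => [|z p IH] x xA /= => [_|/andP[/and3P[_ _ zA] pp]] t.
  by rewrite inE => /eqP->.
by rewrite inE => /predU1P[->//|]; exact: IH.
Qed.

(* Growing W inside X one vertex at a time costs at least one edge per step. *)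
Lemma edge_count_grow X W :
  connected X -> W \subset X -> W != set0 ->
  edge_count W W + 2 * #|X| <= edge_count X X + 2 * #|W|.
Proof.
move=> cX; elim: {W}_.+1 {-2}W (ltnSn (#|X| - #|W|)) => // n IH W Wn sWX W0.
case: (eqVneq W X) => [->//|WX].
have [x [y []]] := cX W sWX W0 WX; rewrite inE => xW /andP[yW yX] gxy.
have ltWX : #|W| < #|X| by rewrite proper_card // properEneq WX.
have cW : #|y |: W| = #|W|.+1 by rewrite cardsU1 yW.
have sW : y |: W \subset X by rewrite subUset sub1set yX.
have := IH (y |: W) _ sW; rewrite cW edge_count_U1 // => /(_ _ _)/wrap[].
  by lia.
  by apply/set0Pn; exists y; rewrite setU11.
have : 0 < deg_in y W by apply: (deg_in_ge1 xW); rewrite gsym.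
lia.
Qed.

End EdgeCounts.

(** * Bonds as cuts with two connected sides; detours of cycles *)

Section BondsAndCycles.
Variables (T : finType) (g : rel T).
Hypotheses (gsym : symmetric g) (girr : irreflexive g).
Implicit Types (A D Q X : {set T}) (B : {set {set T}}) (s p : seq T).

Lemma cut_neq0 X : connected g setT -> X != set0 -> X != setT -> cut g X != set0.
Proof.
move=> cT X0 XT; have [x [y []]] := cT X (subsetT _) X0 XT.
rewrite !inE andbT => xX yX gxy; apply/set0Pn; exists [set x; y].
by rewrite in_cut // xX (negbTE yX).
Qed.

(** If no edge joined [D] to [X :\: D], the cut of [D] would be a nonempty proper part of the cut of
    [X]. *)
Lemma bond_side X : connected g setT -> is_bond g (cut g X) -> X != set0 /\ connected g X.
Proof.
move=> cT /and3P[B0 _ /forallP Bmin]; split.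
  apply: contraNneq B0 => ->; apply/eqP/setP => f; rewrite [RHS]inE.
  by apply/negP => /(mem_cut gsym girr)[x [y []]]; rewrite inE.
move=> D sDX D0 DX; case: (boolP [exists u in D, exists v in X :\: D, g u v]) => [|H].
  by case/exists_inP => u uD /exists_inP[v vD guv]; exists u, v.
have noedge u v : u \in D -> v \in X -> v \notin D -> g u v -> false.
  move=> uD vX vD guv; apply: contraR H => _; apply/exists_inP; exists u => //.
  by apply/exists_inP; exists v; rewrite // inE vD.
have XD0 : X :\: D != set0.
  by rewrite setD_eq0; apply: contra DX => ?; rewrite eqEsubset sDX.
have [t tD] := set0Pn _ D0.
have XDT : X :\: D != setT by apply/negP => /eqP/setP/(_ t); rewrite !inE tD.
have [x [y []]] := cT _ (subsetT _) XD0 XDT.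
rewrite !inE andbT negb_and negbK => /andP[xD xX] yXD gxy.
have yD : y \notin D by apply/negP => yD; have := noedge y x yD xX xD; rewrite gsym => /(_ gxy).
rewrite (negbTE yD) /= in yXD.
(* Properness comes from the edge [[set x; y]], which leaves [X] from a vertex outside [D]. *)
have prD : cut g D \proper cut g X.
  apply/properP; split.
    apply/subsetP => f /(mem_cut gsym girr)[a [b [-> gab aD bD]]].
    rewrite in_cut // (subsetP sDX a aD); case bX: (b \in X) => //.
    by have := noedge a b aD bX bD gab.
  by exists [set x; y]; rewrite !in_cut // ?(negbTE xD) ?(negbTE yD) // xX (negbTE yXD).
have := Bmin (cut g D); rewrite prD /= (_ : is_edge_cut _ _) /=; last first.
  by apply/existsP; exists D.
have DT : D != setT by apply: contraNneq xD => ->; rewrite inE.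
by move/eqP => cD; have := cut_neq0 cT D0 DT; rewrite cD eqxx.
Qed.

(** A smaller cut, given by [D], contains no edge inside either side, so each connected side lies in
    [D] or misses it. An edge of the cut of [X] omitted by the smaller one makes both sides behave
    alike, so the smaller cut is empty. *)
Lemma is_bond_cut X :
  connected g setT -> X != set0 -> ~: X != set0 -> connected g X -> connected g (~: X) ->
  is_bond g (cut g X).
Proof.
move=> cT X0 Y0 cX cY; apply/and3P; split.
- by apply: cut_neq0 => //; apply: contraNneq Y0 => ->; rewrite setCT.
- by apply/existsP; exists X.
apply/forallP => B; apply/implyP => /andP[prB /existsP[D /eqP BD]]; subst B.
have side A : connected g A -> (forall x y, x \in A -> y \in A -> [set x; y] \notin cut g X) ->
    A :&: D = set0 \/ A :&: D = A.
  move=> cA H; case: (eqVneq (A :&: D) set0) => [->|D0]; first by left.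
  case: (eqVneq (A :&: D) A) => [->|DA]; first by right.
  have [x [y []]] := cA _ (subsetIl _ _) D0 DA.
  rewrite !inE => /andP[xA xD] /andP[]; rewrite negb_and => /orP[/negP//|yD] yA gxy.
  have := H x y xA yA; case/negP; apply: (subsetP (proper_sub prB)).
  by rewrite in_cut // xD (negbTE yD).
have inX x y : x \in X -> y \in X -> [set x; y] \notin cut g X.
  move=> xX yX; case gxy: (g x y); first by rewrite in_cut // xX yX.
  apply/negP => /(mem_cut gsym girr)[a [b [E gab aX bX]]].
  have : b \in [set x; y] by rewrite E set22.
  by rewrite !inE => /orP[] /eqP bE; rewrite bE ?xX ?yX in bX.
have inY x y : x \in ~: X -> y \in ~: X -> [set x; y] \notin cut g X.
  rewrite !in_setC => xX yX; apply/negP => /(mem_cut gsym girr)[a [b [E gab aX bX]]].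
  have : a \in [set x; y] by rewrite E set21.
  by rewrite !inE => /orP[] /eqP aE; rewrite aE ?(negbTE xX) ?(negbTE yX) in aX.
have [_ [f fX fD]] := properP prB.
have [x [y [fE gxy xX yX]]] := mem_cut gsym girr fX.
rewrite fE in_cut // negbK in fD.
have mem A z : z \in A -> (A :&: D = set0 \/ A :&: D = A) ->
    forall t, t \in A -> (t \in D) = (z \in D).
  by move=> zA [] /setP E t tA; have := E t; have := E z; rewrite !inE zA tA /= => -> ->.
apply/eqP/setP => h; rewrite [RHS]inE; apply/negP => hD.
have [a [b [hE gab aX bX]]] := mem_cut gsym girr (subsetP (proper_sub prB) h hD).
have ea := mem X x xX (side X cX inX) a aX.
have eb := mem (~: X) y _ (side _ cY inY) b; rewrite !in_setC yX bX in eb.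
by move: hD; rewrite hE in_cut // ea eb // fD.
Qed.

Lemma bond_size_le_max B : is_bond g B -> #|B| <= max_bond_size g.
Proof. exact: leq_bigmax_cond. Qed.

Lemma cycle_size_le_circumference s : is_cycle g s -> size s <= circumference g.
Proof.
move=> cs; have us : uniq s by case/and3P: cs.
have lt : size s < #|T|.+1 by rewrite ltnS -(card_uniqP us) max_card.
apply: (@leq_bigmax_cond _ _ (fun k : 'I_#|T|.+1 => k : nat) (Ordinal lt)).
by apply/existsP; exists (in_tuple s).
Qed.

Lemma next_closed s (P : pred T) x :
  uniq s -> x \in s -> P x -> (forall y, y \in s -> P y -> P (next s y)) ->
  {in s, forall y, P y}.
Proof.
move=> us xs Px H; have [i p Ep] := rot_to xs.
have ms y : (y \in s) = (y \in x :: p) by rewrite -Ep mem_rot.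
have := cycle_next (etrans (rot_uniq i s) us); rewrite Ep /= => pp.
have {}pp : path (frel (next s)) x p.
  move: pp; rewrite rcons_path => /andP[pp _]; move: pp; rewrite -Ep.
  by rewrite (eq_path (e' := frel (next s))) // => y z /=; rewrite next_rot.
move=> y; rewrite ms; have : {subset x :: p <= s} by move=> z; rewrite ms.
elim: p x Px pp {xs Ep ms} => [|z p IH] x Px /=.
  by move=> _ _; rewrite inE => /eqP->.
case/andP=> /eqP xz pp sp; rewrite inE => /predU1P[->//|].
apply: IH => //; first by rewrite -xz; apply: H => //; rewrite sp // mem_head.
by move=> t tp; rewrite sp // inE tp orbT.
Qed.

Lemma cycle_inside s X x :
  is_cycle g s -> cycle_edges s :&: cut g X = set0 -> x \in s -> x \in X -> {subset s <= X}.
Proof.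
case/and3P=> _ us cs /setP E xs xX; apply: (next_closed us xs xX) => y ys yX.
have ye : [set y; next s y] \in cycle_edges s by apply/imsetP; exists y.
have := E [set y; next s y]; rewrite in_setI in_set0 ye in_cut ?next_cycle //.
by move/negbFE/eqP => yE; change (next s y \in X); rewrite -yE.
Qed.

Lemma cycle_split s v : is_cycle g s -> v \in s ->
  exists w u p, [/\ is_cycle g (v :: w :: u :: p), v :: w :: u :: p =i s,
    size (v :: w :: u :: p) = size s, next s v = w & next s w = u].
Proof.
case/and3P=> s2 us cs vs; have [i r Er] := rot_to vs.
have sz : size (v :: r) = size s by rewrite -Er size_rot.
case: r sz Er => [|w [|u p]] sz Er; try by rewrite -sz in s2.
exists w, u, p; rewrite -Er size_rot -!(next_rot i us) Er; split=> //.
- by rewrite -Er /is_cycle size_rot rot_uniq us rot_cycle s2.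
- by move=> z; rewrite -Er mem_rot.
- by rewrite /= eqxx.
have : uniq (v :: w :: u :: p) by rewrite -Er rot_uniq.
by rewrite /= eqxx inE => /andP[/norP[vw _] _]; rewrite eq_sym (negbTE vw).
Qed.

(** The arc [us] is replaced by a path of [Q] from [q] to [q'], with at least two vertices if these
    differ. The cycle thus gets longer when [us] is empty, and also when [us] is a single vertex and
    [q != q']. *)
Lemma cycle_detour v us w p Q q q' :
  is_cycle g (v :: us ++ w :: p) -> connected g Q ->
  {in Q, forall z, z \notin v :: us ++ w :: p} -> q \in Q -> q' \in Q -> g v q -> g w q' ->
  exists2 s, is_cycle g s & (size p + 3 + (q != q')) <= size s.
Proof.
case/and3P=> _; rewrite -cat_cons cat_uniq => /and3P[uus nus uwp].
rewrite /= rcons_cat cat_path => /andP[_ /= /andP[_ pp]] cQ dQ qQ q'Q gvq gwq'.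
have [r [pr lr ur sr]] := connected_join gsym cQ qQ q'Q.
have vwp : v \notin w :: p by apply: contra nus => vp; apply/hasP; exists v => //=; rewrite mem_head.
have dr z : z \in q :: r -> (z != v) && (z \notin w :: p).
  by move/sr/dQ; rewrite inE mem_cat !negb_or => /and3P[-> _ ->].
exists (v :: (q :: r) ++ w :: p).
  apply/and3P; split; first by rewrite /= size_cat /= addnS.
    rewrite -cat_cons cat_uniq uwp andbT cons_uniq ur andbT; apply/andP; split.
      by apply/negP => /dr; rewrite eqxx.
    apply/hasPn => z zp; rewrite inE negb_or; apply/andP; split.
      by apply: contraNneq vwp => <-.
    by apply/negP => /dr; rewrite zp andbF.
  by rewrite /= gvq rcons_cat cat_path pr lr /= gsym gwq' pp.
have : (q != q') <= size r by case: r lr {pr ur sr dr} => [/= ->|*]; [rewrite eqxx|case: eqP].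
rewrite /= size_cat /=; move: (nat_of_bool _) (size r) (size p); clear; lia.
Qed.

End BondsAndCycles.

(** * A longest cycle inside one side of a largest bond: degrees, arcs and exchange *)

Section LongCycleInSide.
Variables (T : finType) (g : rel T) (C : seq T) (X : {set T}).
Hypotheses (gsym : symmetric g) (girr : irreflexive g).
Hypotheses (cardT : 3 < #|T|) (conn3 : forall S : {set T}, #|S| < 3 -> connected g (~: S)).
Hypotheses (cycC : is_cycle g C) (maxC : forall s, is_cycle g s -> size s <= size C).
Hypothesis sCX : {subset C <= X}.
Hypotheses (cX : connected g X) (cY : connected g (~: X)) (Y0 : ~: X != set0).
Hypothesis maxX : forall A : {set T}, A != set0 -> ~: A != set0 ->
  connected g A -> connected g (~: A) -> edge_count g A (~: A) <= edge_count g X (~: X).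
Implicit Types (A B D Q S : {set T}) (x y v w q r : T).

Local Notation CS := [set z in C].

Lemma sCSX : CS \subset X.
Proof. by apply/subsetP => z; rewrite inE; exact: sCX. Qed.

Lemma uniqC : uniq C.
Proof. by case/and3P: cycC. Qed.

Lemma size_C_gt2 : 2 < size C.
Proof. by case/and3P: cycC. Qed.

Lemma cardCS : #|CS| = size C.
Proof. by rewrite cardsE; exact/card_uniqP/uniqC. Qed.

Lemma next_edge v : v \in C -> g v (next C v).
Proof. by apply: next_cycle; case/and3P: cycC. Qed.

Lemma separation D S z :
  #|S| < 3 -> D != set0 -> [disjoint D & S] -> z \notin D -> z \notin S ->
  exists x y, [/\ x \in D, y \notin D, y \notin S & g x y].
Proof.
move=> S3 D0 dDS zD zS.
have [|//||x [y []]] := conn3 S3 (D := D); first by rewrite -disjoints_subset.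
  by apply: contraNneq zD => ->; rewrite inE.
by rewrite !inE => xD /andP[yD yS] gxy; exists x, y.
Qed.

Lemma deg_inTC x A : deg_in g x setT = deg_in g x A + deg_in g x (~: A).
Proof. by rewrite -setTD; exact/deg_in_split/subsetT. Qed.

(** At most two neighbours would separate [x] from some fourth vertex. *)
Lemma degree_ge3 x : 2 < deg_in g x setT.
Proof.
rewrite deg_in_card ltnNge; apply/negP => le2; set S := finset _ in le2.
have xS : x \notin S by rewrite !inE girr.
have [z zx zS] : exists2 z, z != x & z \notin S.
  have : 0 < #|~: (x |: S)|.
    by have := cardsC (x |: S); rewrite cardsU1 xS; move: le2 cardT; lia.
  by case/card_gt0P => z; rewrite !in_setC !in_setU1 negb_or => /andP[]; exists z.
have [|||||y [t []]] := @separation [set x] S z.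
- by move: le2; lia.
- by apply/set0Pn; exists x; rewrite inE.
- by rewrite disjoints1.
- by rewrite inE.
- by [].
by rewrite !inE => /eqP-> _; case: (g x t).
Qed.

Lemma cycle_degree_ge2 v : v \in C -> 1 < deg_in g v CS.
Proof.
case/(cycle_split cycC) => w [u [p [/and3P[_ up cp] ms _ _ _]]].
move: cp; rewrite /= rcons_path => /and3P[gvw _ /andP[_ gl]].
apply: (deg_in_ge2 (y := w) (z := last u p)); rewrite ?inE -?ms ?inE ?eqxx ?orbT //.
- by have := mem_last u p; rewrite inE => ->; rewrite !orbT.
- move: up => /= /and3P[_ wp _]; by apply: contraNneq wp => ->; exact: mem_last.
by rewrite gsym.
Qed.

(** The three neighbours are the successor, the predecessor and the end of the chord; in a triangle
    the last two would coincide. *)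
Lemma cycle_degree_ge3 v :
  v \in C -> 3 < size C -> g v (next C (next C v)) -> 2 < deg_in g v CS.
Proof.
case/(cycle_split cycC) => w [u [p [/and3P[_ up cp] ms <- -> ->]]].
case: p up cp ms => [//|t p] up cp ms _ gvu.
move: cp; rewrite /= rcons_path => /and5P[gvw _ _ _ gl].
have [wl ul] : w != last t p /\ u != last t p.
  move: up => /= /and4P[_ wp up _].
  split; first by apply: contraNneq wp => ->; rewrite inE mem_last orbT.
  by apply: contraNneq up => ->; exact: mem_last.
apply: (deg_in_ge3 (y := w) (z := u) (t := last t p)); rewrite ?inE -?ms ?inE ?eqxx ?orbT //.
- by have := mem_last t p; rewrite inE => ->; rewrite !orbT.
- by move: up => /= /and3P[_ wu _]; apply: contraNneq wu => ->; rewrite mem_head.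
by rewrite gsym.
Qed.

(** Deleting one, two or three consecutive vertices from a cycle leaves a path, which is empty if a
    triangle loses all three. *)
Lemma cycle_arcs v (w := next C v) (u := next C w) : v \in C ->
  [/\ uniq [:: v; w; u], connected g (CS :\ v), connected g (CS :\: (w |: [set v])) &
      connected g (CS :\: (u |: (w |: [set v])))].
Proof.
move=> /(cycle_split cycC)[w' [u' [p [/and3P[_ up cp] ms _ Ew Eu]]]].
rewrite /u /w {w u} Ew Eu {Ew Eu}; rename w' into w; rename u' into u.
have mC z : (z \in C) = [|| z == v, z == w, z == u | z \in p] by rewrite -ms !inE.
move: up cp => /= /and4P[]; rewrite !inE !negb_or => /and3P[vw vu vp] /andP[wu wp] uu _.
rewrite rcons_path => /and3P[_ gwu /andP[pp _]]; split; first by rewrite vw vu wu.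
- rewrite (_ : _ :\ _ = [set z in w :: u :: p]).
    by apply: connected_path => //=; rewrite gwu.
  apply/setP => z; rewrite !inE mC; case: (eqVneq z v) => //= ->.
  by rewrite (negbTE vw) (negbTE vu) (negbTE vp).
- rewrite (_ : _ :\: _ = [set z in u :: p]); first exact: connected_path.
  apply/setP => z; rewrite !inE mC.
  case: (eqVneq z v) => [->|_]; first by rewrite orbT (negbTE vu) (negbTE vp).
  by case: (eqVneq z w) => [->|_] //=; rewrite (negbTE wu) (negbTE wp).
rewrite (_ : _ :\: _ = [set z in p]); last first.
  apply/setP => z; rewrite !inE mC.
  case: (eqVneq z v) => [->|_]; first by rewrite !orbT (negbTE vp).
  case: (eqVneq z w) => [->|_] //=; first by rewrite !orbT (negbTE wp).
  by case: (eqVneq z u) => [->|_] //=; rewrite (negbTE uu).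
case: p pp {mC ms vp wp uu} => [_|t p /= /andP[_ pp]]; last exact: connected_path.
by move=> D sD D0 DA; case/negP: DA; rewrite eqEsubset sD; apply/subsetP => z; rewrite inE.
Qed.

Lemma no_consecutive_neighbours Q v q q' :
  connected g Q -> {in Q, forall z, z \notin C} -> v \in C -> q \in Q -> q' \in Q ->
  g v q -> g (next C v) q' -> False.
Proof.
move=> cQ dQ vC qQ q'Q gvq gwq.
have [w [u [p [cp ms sz Ew _]]]] := cycle_split cycC vC; rewrite Ew in gwq.
have [|s cs] := @cycle_detour _ _ gsym v [::] w (u :: p) Q q q' cp cQ _ qQ q'Q gvq gwq.
  by move=> z /dQ; rewrite ms.
have := maxC cs; rewrite -sz /=; clear; lia.
Qed.

Lemma distance_two_neighbours Q v q q' :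
  connected g Q -> {in Q, forall z, z \notin C} -> v \in C -> q \in Q -> q' \in Q ->
  g v q -> g (next C (next C v)) q' -> q = q'.
Proof.
move=> cQ dQ vC qQ q'Q gvq gwq.
have [w [u [p [cp ms sz Ew Eu]]]] := cycle_split cycC vC; rewrite Ew Eu in gwq.
have [|s cs] := @cycle_detour _ _ gsym v [:: w] u p Q q q' cp cQ _ qQ q'Q gvq gwq.
  by move=> z /dQ; rewrite ms.
have := maxC cs; rewrite -sz /=; case: eqP => //= _; clear; lia.
Qed.

(** The cuts of [X] and [X :\: S] share the edges between [X :\: S] and [~: X]; what remains of each
    is compared by maximality. *)
Lemma bond_exchange S :
  S \subset X -> X :\: S != set0 -> connected g (X :\: S) -> connected g (S :|: ~: X) ->
  edge_count g S (X :\: S) <= edge_count g S (~: X).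
Proof.
move=> sSX XS0 cXS cYS.
have E : ~: (X :\: S) = S :|: ~: X by rewrite setCD setUC.
have := maxX XS0; rewrite E => /(_ _ cXS cYS).
have -> : S :|: ~: X != set0.
  by have [y yY] := set0Pn _ Y0; apply/set0Pn; exists y; rewrite inE yY orbT.
move/(_ isT); rewrite (edge_count_splitr gsym (X :\: S) (subsetUl S (~: X))).
have -> : (S :|: ~: X) :\: S = ~: X.
  rewrite setDUl setDv set0U; apply/setDidPl; rewrite disjoints_subset setCS //.
by rewrite (edge_count_splitl g (~: X) sSX) (edge_countC gsym (X :\: S) S) leq_add2r.
Qed.

(** * Hypothesis (ii): few edges inside the two sides *)

(** If [q] were in [~: X], moving [r] across would give up a single edge to [~: X] and gain at least
    two, from the cycle neighbours of [r]. *)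
Lemma sole_neighbour_not_opposite Q r q :
  connected g Q -> ~: X \subset Q -> {in Q, forall z, z \notin C} ->
  (forall x z, x \in Q -> z \notin C -> g x z -> z \in Q) ->
  r \in C -> q \in Q -> g r q -> (forall z, z \in Q -> g r z -> z = q) -> q \in X.
Proof.
move=> cQ sYQ dQ clQ rC qQ grq qonly; apply: contraT => qX.
have [_ carc _ _] := cycle_arcs rC.
have rX := sCX rC.
have arc0 : CS :\ r != set0.
  have := cardsD1 r CS; rewrite cardCS inE rC => E.
  by rewrite -card_gt0; have := size_C_gt2; lia.
have cXr : connected g (X :\: [set r]).
  apply: (connected_extend gsym (setSD _ sCSX) arc0 carc) => D sD D0.
  have sDX z : z \in D -> z \in X /\ z \notin C.
    by move/(subsetP sD); rewrite !inE => /andP[+ /andP[nr zX]]; rewrite nr zX.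
  (* For [D] inside [Q], an edge leaving [D] within [X] cannot end in [r], whose only neighbour in
     [Q] is outside [X]. Otherwise an edge leaves [D :\: Q] avoiding [r], and it cannot enter [Q]
     since [Q] is closed off [C]. *)
  case: (eqVneq (D :\: Q) set0) => [/eqP|DQ0].
    rewrite setD_eq0 => sDQ.
    have [||x [y []]] := cX (D := D) _ D0.
    - by apply/subsetP => z /sDX[].
    - by apply: contraTneq rX => <-; apply/negP => /sDX[_]; rewrite rC.
    rewrite !inE => xD /andP[yD yX] gxy; exists x, y; rewrite !inE yD yX andbT; split=> //.
    apply: contraNneq qX => yr; rewrite -(qonly x) ?(subsetP sDQ) ?(sDX x xD).1 //.
    by rewrite gsym -yr.
  have [|||||x [y []]] := @separation (D :\: Q) [set r] q.
  - by rewrite cards1.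
  - by [].
  - by rewrite disjoint_sym disjoints1 !inE; apply/negP => /andP[_ /sDX[_]]; rewrite rC.
  - by rewrite inE qQ.
  - by rewrite inE; apply: contraTneq (dQ q qQ) => ->; rewrite rC.
  rewrite !inE => /andP[xQ xD]; rewrite negb_and negbK => ynD yr gxy.
  have yQ : y \notin Q.
    by apply: contra xQ => yQ; apply: clQ yQ (sDX x xD).2 _; rewrite gsym.
  exists x, y; rewrite !inE yr xD (negbTE yQ) /= in ynD *; split=> //.
  by rewrite ynD /=; apply: contraR yQ => yX; apply: (subsetP sYQ); rewrite inE.
have cYr : connected g ([set r] :|: ~: X).
  by apply: (connected_setU1 gsym cY _ grq); rewrite inE.
have sr : [set r] \subset X by rewrite sub1set.
have Xr0 : X :\: [set r] != set0.
  by apply: contraNneq arc0 => E; rewrite -subset0 -E setSD ?sCSX.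
have sq : [set q] \subset ~: X by rewrite sub1set inE.
have dY : deg_in g r (~: X) = 1.
  rewrite (deg_in_split g r sq) deg_in1 grq deg_in_eq0 // => z; rewrite !inE => /andP[zq zX].
  by apply: contra zq => grz; apply/eqP/qonly => //; apply: (subsetP sYQ); rewrite inE.
have := bond_exchange sr Xr0 cXr cYr; rewrite !edge_count1 dY.
have := deg_in_split g r sr; rewrite deg_in1 girr add0n => <-.
have := leq_trans (cycle_degree_ge2 rC) (deg_in_subset g r sCSX).
by case: (deg_in _ _ _) => [|[]].
Qed.

Lemma sparse_sides_absurd :
  edge_count g X X + edge_count g (~: X) (~: X) <= 2 * #|T| + 2 -> False.
Proof.
move=> few.
(* The connected set [~: X] has at least [#|~: X| - 1] inner edges, which bounds what is left for
   [X]. *)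
have eX : edge_count g X X <= 2 * #|X| + 4.
  have [y yY] := set0Pn _ Y0.
  have := edge_count_grow gsym girr cY (W := [set y]); rewrite sub1set yY cards1.
  have -> : [set y] != set0 by apply/set0Pn; exists y; rewrite inE.
  move/(_ isT isT); move: few (cardsC X); clear; lia.
(* A maximal such set containing [~: X] is closed under edges to vertices off [C], hence a component
   of the graph without [C]. *)
pose P A := induced_connected g A && (A \subset ~: CS).
have PY : P (~: X) by apply/andP; split; [exact/(connectedP gsym)|rewrite setCS sCSX].
have [Q /maxsetP[/andP[/(connectedP gsym) cQ dQ] maxQ] sYQ] := maxset_exists PY.
have {}dQ : {in Q, forall z, z \notin C} by move=> z /(subsetP dQ); rewrite !inE.
have clQ x z : x \in Q -> z \notin C -> g x z -> z \in Q.
  move=> xQ zC gxz; rewrite -(maxQ (z |: Q)) ?setU11 ?subsetU1 //.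
  apply/andP; split; first by apply/(connectedP gsym)/(connected_setU1 gsym cQ xQ); rewrite gsym.
  by apply/subsetP => t; rewrite !inE => /predU1P[->//|/dQ].
pose R := [set c in CS | [exists q in Q, g c q]].
have RP c : reflect (c \in C /\ exists2 q, q \in Q & g c q) (c \in R).
  by rewrite !inE; apply: (iffP andP) => -[cC] => [/exists_inP|[q qQ gcq]];
    split=> //; apply/exists_inP; exists q.
pose U := CS :\: R.
have [v vC] : exists v, v \in C by case: (C) size_C_gt2 => // v s _; exists v; rewrite mem_head.
have nextC c : c \in C -> next C c \in C by rewrite mem_next.
have nextR c : c \in R -> next C c \in U.
  case/RP=> cC [q qQ gcq]; rewrite in_setD inE nextC // andbT.
  by apply/negP => /RP[_ [q' q'Q gcq']]; apply: no_consecutive_neighbours cC qQ q'Q gcq gcq'.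
have nextI : {in R &, injective (next C)} by move=> a b _ _; apply: can_inj (prev_next uniqC) _ _.
have RU : #|R| <= #|U|.
  by rewrite -(card_in_imset nextI) subset_leq_card //; apply/subsetP => _ /imsetP[c cR ->];
    exact: nextR.
have sQ0 : Q != set0.
  by have [y yY] := set0Pn _ Y0; apply/set0Pn; exists y; apply: (subsetP sYQ).
(* All edges leaving [Q] end in [R], so a smaller [R] would separate [Q] from a vertex of [U]. *)
have R3 : 2 < #|R|.
  rewrite ltnNge; apply/negP => R2.
  have [z zU] : exists z, z \in U.
    case: (boolP (v \in R)) => [/nextR|vR]; first by exists (next C v).
    by exists v; rewrite in_setD inE vC vR.
  move: zU; rewrite in_setD inE => /andP[zR zC].
  have [||||x [y []]] := @separation Q R z _ sQ0.
  - by [].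
  - by rewrite disjoints_subset; apply/subsetP => t /dQ tC; rewrite inE; apply: contra tC => /RP[].
  - by apply: contraL zC => /dQ.
  - by [].
  move=> xQ yQ yR gxy; case: (boolP (y \in C)) => yC; last by rewrite (clQ x) in yQ.
  by case/RP: yR; split=> //; exists x; rewrite // gsym.
pose W := ~: Q.
have sWX : W \subset X by rewrite -(setCK X) setCS.
have sCW : CS \subset W by apply/subsetP => z; rewrite !inE; apply: contraL => /dQ.
have sUW : U \subset W by apply: subset_trans (subsetDl _ _) sCW.
have sRW r : r \in R -> r \in W by case/RP => rC _; apply: (subsetP sCW); rewrite inE.
have WQ0 x : x \in W -> x \notin R -> 2 < deg_in g x W.
  move=> xW xR; have := degree_ge3 x; rewrite (deg_inTC x Q) deg_in_eq0 // => q qQ.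
  apply: contra xR => gxq; apply/RP; case: (boolP (x \in C)) => [xC|xC]; first by split=> //; exists q.
  by move: xW; rewrite inE (clQ q) // gsym.
have W0 : W != set0 by apply/set0Pn; exists v; apply: (subsetP sCW); rewrite inE.
(* Vertices of [W] outside [R] keep all their neighbours in [W], hence at least three; those of [R]
   have their two cycle neighbours there. *)
have eW : 2 * #|W| + #|U| <= edge_count g W W.
  have cW := cardsD W U; rewrite (setIidPr sUW) in cW.
  rewrite (edge_count_splitl g W sUW).
  have eU : 3 * #|U| <= edge_count g U W.
    by apply: edge_count_ge => x xU; apply: WQ0; [exact: (subsetP sUW)|case/setDP: xU].
  have eWU : 2 * #|W :\: U| <= edge_count g (W :\: U) W.
    apply: edge_count_ge => x /setDP[xW _]; case: (boolP (x \in R)) => [/RP[xC _]|xR].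
      exact: leq_trans (cycle_degree_ge2 xC) (deg_in_subset g x sCW).
    exact: ltnW (WQ0 x xW xR).
  by move: (subset_leq_card sUW) cW eU eWU; clear; lia.
have key (W' : {set T}) : W' \subset X -> W \subset W' ->
    edge_count g W' W' + 2 * #|X| <= edge_count g X X + 2 * #|W'|.
  move=> sW'X sWW'; apply: edge_count_grow => //.
  by apply: contraNneq W0 => E; rewrite -subset0 -E.
have U4 : #|U| <= 4 by move: (key W sWX (subxx _)) eW eX; clear; lia.
case: (boolP [exists r in R, next C (next C r) \in R]) => [|H].
  case/exists_inP=> r rR r'R; set r' := next C (next C r) in r'R.
  case/RP: (rR) => rC [q qQ grq]; case/RP: (r'R) => r'C [q' q'Q gr'q'].
  have E a b : a \in Q -> b \in Q -> g r a -> g r' b -> a = b.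
    by move=> aQ bQ; exact: distance_two_neighbours cQ dQ rC aQ bQ.
  have qX : q \in X.
    apply: (sole_neighbour_not_opposite cQ sYQ dQ clQ rC qQ grq) => z zQ grz.
    by rewrite (E z q') // -(E q q').
  have qq' : q = q' by apply: E.
  have gr'q : g r' q by rewrite qq'.
  have rr' : r != r'.
    by case: (cycle_arcs rC) => /= /andP[]; rewrite !inE negb_or => /andP[].
  have qW : q \notin W by rewrite inE negbK.
  have dq : 1 < deg_in g q W.
    by apply: (deg_in_ge2 (sRW r rR) (sRW r' r'R) rr'); rewrite gsym.
  (* Adding [q] brings two edges, one more than growth requires, so [#|U| <= 2], against
     [#|R| <= #|U|] and [2 < #|R|]. *)
  have := key (q |: W); rewrite subUset sub1set qX sWX subsetU1 cardsU1 qW edge_count_U1 //.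
  by move/(_ isT isT); move: eW eX dq RU R3; clear; lia.
have nextR2 c : c \in R -> next C (next C c) \in U.
  move=> cR; rewrite in_setD inE !nextC //; last by case/RP: cR.
  by rewrite andbT; apply: contra H => H; apply/exists_inP; exists c.
(* The first and second successors of [R] form disjoint subsets of [U], so [#|U|] would be at least
   six. *)
have : #|next C @: R :|: next C @: (next C @: R)| <= #|U|.
  apply/subset_leq_card/subsetP => z; rewrite inE => /orP[] /imsetP[c cR ->]; first exact: nextR.
  by case/imsetP: cR => d dR ->; exact: nextR2.
have nI : injective (next C) by exact: can_inj (prev_next uniqC).
rewrite cardsU !card_imset // (_ : _ :&: _ = set0) ?cards0; first by move: R3 U4; clear; lia.
apply/setP => z; rewrite !inE; apply/negP => /andP[/imsetP[a aR ->] /imsetP[b /imsetP[c cR ->]]].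
by move/nI => E; move: (nextR c cR); rewrite -E in_setD aR.
Qed.

(** * Hypothesis (i): a cycle missing at most three vertices *)

(** If [~: X] were a single vertex, moving a neighbour [v] of it would give up one edge and gain at
    least two; [X] without [v] stays connected because only two vertices are removed from the
    graph. *)
Lemma opposite_side_gt1 : 1 < #|~: X|.
Proof.
rewrite ltnNge; apply/negP => le1.
have [y Ey] : exists y, ~: X = [set y].
  by apply/cards1P; rewrite eqn_leq le1 card_gt0 Y0.
have [v _ gyv] := deg_in_gt0P (ltnW (ltnW (degree_ge3 y))).
have vy : v != y by apply: contraTneq gyv => ->; rewrite girr.
have vX : [set v] \subset X by rewrite sub1set -(setCK X) Ey !inE.
have Xv : X :\: [set v] = ~: [set y; v] by rewrite -(setCK X) Ey setDE -setCU.
have cXv : connected g (X :\: [set v]).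
  by rewrite Xv; apply: conn3; rewrite cards2; case: (_ != _).
have Xv0 : X :\: [set v] != set0.
  rewrite -card_gt0 cardsD (setIidPr vX) cards1.
  by move: (subset_leq_card sCSX) size_C_gt2; rewrite cardCS; clear; lia.
have cYv : connected g ([set v] :|: ~: X).
  by apply: (connected_setU1 gsym cY (y := y)); rewrite ?Ey ?inE // gsym.
have := bond_exchange vX Xv0 cXv cYv; rewrite !edge_count1.
have := deg_in_split g v vX; rewrite deg_in1 girr add0n => <-.
move: (degree_ge3 v) (deg_in_le_card g v (~: X)) le1; rewrite (deg_inTC v X); clear; lia.
Qed.

(** The last clause keeps [X] connected once [v] and its successor are moved: a vertex of [X] off
    [C] still has a neighbour on the remaining arc. *)
Lemma exists_exchangeable_vertex :
  #|X :\: CS| <= 1 ->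
  exists v Q, [/\ v \in C, exists2 y, y \in ~: X & g v y,
    connected g Q /\ ~: X \subset Q, {in Q, forall z, z \notin C} &
    forall x, x \in X :\: CS -> exists t, [/\ t \in C, t != v, t != next C v & g x t]].
Proof.
have dYC : {in ~: X, forall z, z \notin C}.
  by move=> z; rewrite inE; apply: contra; exact: sCX.
have disjY S : S \subset X -> [disjoint ~: X & S] by move=> sS; rewrite disjoints_subset setCS.
have [y0 y0Y] := set0Pn _ Y0.
have [c0 c0C] : exists c, c \in C by case: (C) size_C_gt2 => // c s _; exists c; rewrite mem_head.
rewrite leq_eqVlt => /orP[/cards1P[x Ex]|]; last first.
  rewrite ltnS leqn0 cards_eq0 => /eqP Z0.
  have [||||y [v [yY vY _ gyv]]] := @separation (~: X) set0 c0 _ Y0.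
  - by rewrite cards0.
  - by apply: disjY; rewrite sub0set.
  - by rewrite inE negbK sCX.
  - by rewrite inE.
  have vC : v \in C.
    by move/setP/(_ v): Z0; rewrite !inE; move: vY; rewrite inE negbK => ->; rewrite andbT => /negbFE.
  exists v, (~: X); split=> //; first by exists y; rewrite // gsym.
  by move=> z; rewrite Z0 inE.
have /setDP[xX] : x \in X :\: CS by rewrite Ex inE.
rewrite inE => xC.
have inC z : z \in X -> z != x -> z \in C.
  by move=> zX zx; move/setP/(_ z): Ex; rewrite !inE zX (negbTE zx) andbT => /negbFE.
have [|||x' [u []]] := cX (D := [set x]).
- by rewrite sub1set.
- by apply/set0Pn; exists x; rewrite inE.
- by apply: contraTneq (sCX c0C) => <-; rewrite inE; apply: contraNneq xC => <-.
rewrite !inE => /eqP-> /andP[ux uX] gxu.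
have uC := inC u uX ux.
have [c cC cu] : exists2 c, c \in C & c != u.
  by exists (next C u); rewrite ?mem_next //; apply: contraTneq (next_edge uC) => ->; rewrite girr.
have cx : c != x by apply: contraNneq xC => <-.
(* Avoiding [u] as well as [x] makes [u] available as the neighbour of [x] other than [v]. *)
have [||||y [v [yY vY vxu gyv]]] := @separation (~: X) [set x; u] c _ Y0.
- by rewrite cards2; case: (_ != _).
- by apply: disjY; rewrite subUset !sub1set xX.
- by rewrite inE negbK sCX.
- by rewrite !inE negb_or cx.
rewrite inE negbK in vY; move: vxu; rewrite !inE negb_or => /andP[vx vu].
have vC := inC v vY vx.
(* If [x] is adjacent to [~: X], it joins [Q], and then [u] cannot be the successor of [v]. If not,
   its three or more neighbours all lie on [C], and one differs from [v] and its successor. *)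
case: (boolP [exists y1 in ~: X, g x y1]) => [/exists_inP[y1 y1Y gxy1]|noY].
  have dQ : {in x |: ~: X, forall z, z \notin C} by move=> z /setU1P[->//|/dYC].
  have cQ := connected_setU1 gsym cY y1Y gxy1.
  exists v, (x |: ~: X); split=> //; [by exists y; rewrite // gsym|by split; rewrite ?subsetU1|].
  move=> z; rewrite Ex inE => /eqP->; exists u; rewrite uC eq_sym vu gxu; split=> //.
  apply/eqP => E; apply: (no_consecutive_neighbours cQ dQ vC (q := y) (q' := x)).
  - by rewrite inE yY orbT.
  - exact: setU11.
  - by rewrite gsym.
  by rewrite -E gsym.
exists v, (~: X); split=> //; first by exists y; rewrite // gsym.
move=> z; rewrite Ex inE => /eqP->.
have [t] : exists2 t, t \in setT :\: [set v; next C v] & g x t.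
  apply: deg_in_gt0P; have := degree_ge3 x.
  rewrite (deg_in_split g x (subsetT [set v; next C v])).
  have : #|[set v; next C v]| <= 2 by rewrite cards2; case: (_ != _).
  by move: (deg_in_le_card g x [set v; next C v]); clear; lia.
rewrite !inE negb_or andbT => /andP[tv tw] gxt; exists t; split=> //.
apply: inC; last by apply: contraTneq gxt => ->; rewrite girr.
by apply: contraR noY => tX; apply/exists_inP; exists t; rewrite // inE.
Qed.

Lemma long_cycle_absurd : #|T| <= size C + 3 -> False.
Proof.
move=> long.
have Y2 := opposite_side_gt1.
have cardXC : #|X :\: CS| + size C + #|~: X| <= size C + 3.
  rewrite cardsD (setIidPr sCSX); move: (subset_leq_card sCSX) (cardsC X) long.
  by rewrite cardCS; clear; lia.
have [|v [Q [vC [y yY gvy] [cQ sYQ] dQ attach]]] := exists_exchangeable_vertex.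
  by move: Y2 cardXC; clear; lia.
set w := next C v in attach; pose u := next C w.
have wC : w \in C by rewrite mem_next.
have uC : u \in C by rewrite mem_next.
have [/= /and3P[]] := cycle_arcs vC; rewrite -/w -/u !inE negb_or => /andP[vw vu] wu _ _ arc2 arc3.
have gvw : g v w := next_edge vC.
have gwu : g w u := next_edge wC.
have wQ q : q \in Q -> ~~ g w q.
  move=> qQ; apply/negP => gwq.
  exact: no_consecutive_neighbours cQ dQ vC (subsetP sYQ _ yY) qQ gvy gwq.
have dwY : deg_in g w (~: X) = 0 by apply: deg_in_eq0 => q /(subsetP sYQ)/wQ.
have dwX : 2 < deg_in g w X by have := degree_ge3 w; rewrite (deg_inTC w X) dwY addn0.
have dvX : 1 < deg_in g v X := leq_trans (cycle_degree_ge2 vC) (deg_in_subset g v sCSX).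
pose S2 := w |: [set v].
have wv : w \notin [set v] by rewrite inE eq_sym.
have sS2C : S2 \subset CS by rewrite subUset !sub1set !inE wC.
have sS2 : S2 \subset X := subset_trans sS2C sCSX.
have cYS2 : connected g (S2 :|: ~: X).
  rewrite -setUA; apply: (connected_setU1 gsym (y := v)); last by rewrite gsym.
    by apply: (connected_setU1 gsym cY yY gvy).
  by rewrite !inE eqxx.
have u2 : u \in CS :\: S2 by rewrite !inE uC negb_or eq_sym wu eq_sym vu.
have arc20 : CS :\: S2 != set0 by apply/set0Pn; exists u.
have cXS2 : connected g (X :\: S2).
  apply: (connected_extend gsym (setSD _ sCSX) arc20 arc2) => D sD /set0Pn[x xD].
  have sDZ z : z \in D -> z \in X :\: CS.
    move/(subsetP sD); rewrite in_setD => /andP[]; rewrite !in_setD negb_and negbK.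
    by case/orP=> [->//|zC /andP[_ ->]]; rewrite zC.
  have [t [tC tv tw gxt]] := attach x (sDZ x xD); exists x, t; split=> //.
  rewrite !inE (negbTE tv) (negbTE tw) sCX //= andbT.
  by apply/negP => /sDZ; rewrite !inE tC.
have XS20 : X :\: S2 != set0 by apply/set0Pn; exists u; apply: (subsetP (setSD _ sCSX)).
(* The 2 accounts for the edge between [v] and [w], counted from both ends; [w] has no neighbour in
   [~: X]. *)
have exch2 : deg_in g v X + deg_in g w X <= deg_in g v (~: X) + 2.
  have := bond_exchange sS2 XS20 cXS2 cYS2; rewrite !edge_count_U1l // !edge_count1 dwY.
  rewrite (deg_in_split g v sS2) (deg_in_split g w sS2).
  by rewrite !deg_in_U1 // !deg_in1 !girr gvw (gsym w v) gvw; clear; lia.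
have dvY : 2 < deg_in g v (~: X) by move: dvX dwX exch2; clear; lia.
(* Three neighbours of [v] in [~: X] use up all the vertices that [C] may miss. *)
have [Y3 XC] : #|~: X| = 3 /\ X = CS.
  have le := leq_trans dvY (deg_in_le_card g v (~: X)).
  split; first by move: le cardXC; clear; lia.
  apply/eqP; rewrite eqEsubset sCSX andbT -setD_eq0 -cards_eq0.
  by move: le cardXC; clear; lia.
(* A neighbour of [u] in [~: X] would have to equal each of two distinct neighbours of [v], as [u]
   is at distance two from [v] on [C]. *)
have uY z : z \in ~: X -> ~~ g u z.
  move=> zY; apply/negP => guz.
  move: dvY; rewrite deg_in_card => /ltnW/card_gt1P[a [b []]].
  rewrite !in_set => /andP[aX gva] /andP[bX gvb] ab.
  have E t : t \notin X -> g v t -> t = z.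
    move=> tX gvt; apply: (distance_two_neighbours cQ dQ vC _ _ gvt guz).
      by apply: (subsetP sYQ); rewrite inE.
    exact: (subsetP sYQ).
  by case/eqP: ab; rewrite (E a) // (E b).
have duY : deg_in g u (~: X) = 0 by apply: deg_in_eq0.
have duX : 2 < deg_in g u X by have := degree_ge3 u; rewrite (deg_inTC u X) duY addn0.
pose S3 := u |: S2.
have uS2 : u \notin S2 by case/setDP: u2.
have sS3 : S3 \subset X by rewrite subUset sub1set sCX.
have dv3 : deg_in g v (~: X) <= 3 by rewrite -Y3 deg_in_le_card.
have dv2 : deg_in g v X <= 2 by move: dwX dv3 exch2; clear; lia.
(* If [X] were just these three vertices, [v] alone would separate [~: X] from [w]. *)
have XS30 : X :\: S3 != set0.
  apply/negP => /eqP/eqP; rewrite setD_eq0 => sXS3.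
  have [||||a [b [aY bY bv gab]]] := @separation (~: X) [set v] w _ Y0.
  - by rewrite cards1.
  - by rewrite disjoint_sym disjoints1 inE negbK sCX.
  - by rewrite inE negbK sCX.
  - by rewrite inE eq_sym.
  rewrite inE negbK in bY; move/(subsetP sXS3): bY bv; rewrite !inE gsym in gab *.
  case/or3P=> /eqP E; rewrite E ?eqxx // in gab *.
    by have := uY a aY; rewrite gab.
  by have := wQ a (subsetP sYQ a aY); rewrite gab.
have C4 : 3 < size C.
  move: XS30; rewrite -card_gt0 cardsD (setIidPr sS3) XC cardCS !cardsU1 uS2 wv cards1.
  by clear; lia.
(* This chord would give [v] a third neighbour on [C], against [dv2]. *)
have gvu : g v u = false.
  apply/negP => gvu; have := leq_trans (cycle_degree_ge3 vC C4 gvu) (deg_in_subset g v sCSX).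
  by rewrite ltnNge dv2.
have cXS3 : connected g (X :\: S3) by rewrite XC.
have cYS3 : connected g (S3 :|: ~: X).
  rewrite -setUA; apply: (connected_setU1 gsym cYS2 (y := w)); last by rewrite gsym.
  by rewrite !inE eqxx.
(* Outside [S3] but in [X], the vertices [v], [w], [u] have at least 1, 1 and 2 neighbours, while
   only [v] has neighbours in [~: X], at most three. *)
have := bond_exchange sS3 XS30 cXS3 cYS3; rewrite !edge_count_U1l // !edge_count1 dwY duY.
move: dvX dwX duX dv3; rewrite (deg_in_split g v sS3) (deg_in_split g w sS3) (deg_in_split g u sS3).
rewrite !deg_in_U1 // !deg_in1 !girr gvw gvu gwu (gsym w v) gvw (gsym u v) gvu (gsym u w) gwu.
by clear; lia.
Qed.

End LongCycleInSide.

(** * Assembly: choosing the side that contains the cycle *)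

Theorem theorem1p4 (T : finType) (g : rel T) :
  simple_graph g ->
  k_connected g 3 ->
  (#|T| <= circumference g + 3 \/ #|edges g| <= max_bond_size g + #|T| + 1) ->
  forall (C : seq T) (B : {set {set T}}),
    is_cycle g C -> size C = circumference g ->
    is_bond g B -> #|B| = max_bond_size g ->
    cycle_edges C :&: B != set0.
Proof.
move=> [gsym girr] /andP[cardT /forallP conn] hyp C B cycC szC bB szB.
have conn3 (S : {set T}) : #|S| < 3 -> connected g (~: S).
  by move=> S3; apply/(connectedP gsym); exact: implyP (conn S) S3.
have cT : connected g setT by rewrite -setC0; apply: conn3; rewrite cards0.
have /and3P[_ /existsP[X /eqP BX] _] := bB; subst B.
apply/negP => /eqP avoid.
(* A set and its complement have the same cut, so this form serves whichever side contains [C]. *)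
have absurd (A : {set T}) : cut g A = cut g X -> {subset C <= A} -> False.
  move=> cutA sCA.
  have bA : is_bond g (cut g A) by rewrite cutA.
  have bA' : is_bond g (cut g (~: A)) by rewrite cutC // cutA.
  have [A0 cA] := bond_side gsym girr cT bA.
  have [A'0 cA'] := bond_side gsym girr cT bA'.
  have maxC s : is_cycle g s -> size s <= size C.
    by rewrite szC; exact: cycle_size_le_circumference.
  have maxA (D : {set T}) : D != set0 -> ~: D != set0 -> connected g D -> connected g (~: D) ->
      edge_count g D (~: D) <= edge_count g A (~: A).
    move=> D0 D'0 cD cD'; rewrite -!card_cut // cutA szB.
    exact/bond_size_le_max/is_bond_cut.
  case: hyp => [long|few].
    by apply: (long_cycle_absurd gsym girr cardT conn3 cycC maxC sCA cA cA' A'0 maxA); rewrite szC.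
  apply: (sparse_sides_absurd gsym girr cardT conn3 cycC maxC sCA cA cA' A'0 maxA).
  (* Twice the number of edges is the sum of both inner counts and twice the bond, which turns (ii)
     into the bound [2 * #|T| + 2]. *)
  have := card_edges gsym girr; rewrite (edge_count_splitl g _ (subsetT A)) setTD.
  rewrite !(edge_count_splitr gsym _ (subsetT A)) !setTD (edge_countC gsym (~: A) A).
  by move: few; rewrite -szB -cutA (card_cut gsym girr); clear; lia.
have [c cC] : exists c, c \in C.
  by case/and3P: cycC; case: (C) => // c s _ _ _; exists c; rewrite mem_head.
case: (boolP (c \in X)) => cX; first exact: absurd X erefl (cycle_inside girr cycC avoid cC cX).
apply: (absurd (~: X)); first exact: cutC.
by apply: (cycle_inside girr cycC _ cC); rewrite ?cutC // inE.
Qed.
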